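(* Let $(A,\cdot,\{~,~,~\},\{\!\{~,~,~\}\!\})$ be an associative-Yamaguti algebra. If $(A[[t]],\mu_t,F_t,G_t)$ and $(A[[t]],\mu'_t,F'_t,G'_t)$ are equivalent formal deformations of $A$, then their infinitesimals $(\mu_1,F_1,G_1)$ and $(\mu'_1,F'_1,G'_1)$ differ by a $(2,3)$-coboundary. Therefore, the infinitesimals corresponding to equivalent deformations give rise to the same element in $\mathcal{H}^{(2,3)}(A,A)$.
   Context: All vector spaces, linear maps and tensor products are over a field $\mathbf{k}$ of characteristic $0$ unless indicated. An associative-Yamaguti algebra is a quadruple $(A,\cdot,\{~,~,~\},\{\!\{~,~,~\}\!\})$ consisting of a vector space $A$ with linear operations $\cdot:A\otimes A\to A$ and $\{~,~,~\},\{\!\{~,~,~\}\!\}:A\otimes A\otimes A\to A$ such that for all $a,b,c,d,e\in A$: (AY1) $(a\cdot b)\cdot c-a\cdot(b\cdot c)+\{a,b,c\}-\{\!\{a,b,c\}\!\}=0$; (AY2) $\{a\cdot b,c,d\}=\{a,b\cdot c,d\}$; (AY3) $\{a,b,c\cdot d\}=\{a,b,c\}\cdot d$; (AY4) $\{\!\{a\cdot b,c,d\}\!\}=a\cdot\{\!\{b,c,d\}\!\}$; (AY5) $\{\!\{a,b\cdot c,d\}\!\}=\{\!\{a,b,c\cdot d\}\!\}$; (AY6) $a\cdot\{b,c,d\}=\{\!\{a,b,c\}\!\}\cdot d$; (AY7) $\{\{a,b,c\},d,e\}=\{a,\{\!\{b,c,d\}\!\},e\}=\{a,b,\{c,d,e\}\}$;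 (AY8) $\{a,\{b,c,d\},e\}=\{\{\!\{a,b,c\}\!\},d,e\}$; (AY9) $\{\!\{\{\!\{a,b,c\}\!\},d,e\}\!\}=\{\!\{a,\{b,c,d\},e\}\!\}=\{\!\{a,b,\{\!\{c,d,e\}\!\}\}\!\}$; (AY10) $\{\!\{a,\{\!\{b,c,d\}\!\},e\}\!\}=\{\!\{a,b,\{c,d,e\}\}\!\}$; (AY11) $\{a,b,\{\!\{c,d,e\}\!\}\}=\{\!\{\{a,b,c\},d,e\}\!\}$. An associative-Yamaguti algebra over $\mathbf{k}[[t]]$ is defined in the same way with $\mathbf{k}[[t]]$-modules and $\mathbf{k}[[t]]$-linear operations; homomorphisms are linear maps preserving the three operations. Let $A[[t]]$ be the $\mathbf{k}[[t]]$-module of formal power series in $t$ with coefficients in $A$. A formal ($1$-parameter) deformation of $A$ consists of $\mathbf{k}[[t]]$-multilinear operations $\mu_t$ (binary), $F_t,G_t$ (ternary) on $A[[t]]$ of the form, for elements $a,b,c\in A$, $\mu_t(a,b)=a\cdot b+\sum_{i\ge1}t^i\mu_i(a,b)$, $F_t(a,b,c)=\{a,b,c\}+\sum_{i\ge1}t^iF_i(a,b,c)$, $G_t(a,b,c)=\{\!\{a,b,c\}\!\}+\sum_{i\ge1}t^iG_i(a,b,c)$, with linear maps $\mu_i:A^{\otimes2}\to A$, $F_i,G_i:A^{\otimes3}\to A$, such that $(A[[t]],\mu_t,F_t,G_t)$ is an associative-Yamaguti algebra over $\mathbf{k}[[t]]$. Its infinitesimal is $(\mu_1,F_1,G_1)$;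 it is a $(2,3)$-cocycle (defined below). Two formal deformations $(A[[t]],\mu_t,F_t,G_t)$ and $(A[[t]],\mu'_t,F'_t,G'_t)$ are equivalent if there is a $\mathbf{k}[[t]]$-linear map $\varphi_t:A[[t]]\to A[[t]]$ of the form $\varphi_t(a)=a+t\varphi_1(a)+t^2\varphi_2(a)+\cdots$ for $a\in A$ (with linear maps $\varphi_i:A\to A$) that is a homomorphism of associative-Yamaguti algebras from the first to the second. Cohomology with coefficients in the adjoint representation ($A$ acting on itself by its structure operations): a $(2,3)$-cocycle is a triple $(\mu,F,G)$ of linear maps $\mu:A^{\otimes2}\to A$, $F,G:A^{\otimes3}\to A$ such that for all $a,b,c,d,e\in A$: (1) $\mu(a,b)\cdot c+\mu(a\cdot b,c)-a\cdot\mu(b,c)-\mu(a,b\cdot c)+F(a,b,c)-G(a,b,c)=0$; (2) $\{\mu(a,b),c,d\}+F(a\cdot b,c,d)=\{a,\mu(b,c),d\}+F(a,b\cdot c,d)$; (3) $\{a,b,\mu(c,d)\}+F(a,b,c\cdot d)=\mu(\{a,b,c\},d)+F(a,b,c)\cdot d$; (4) $\{\!\{\mu(a,b),c,d\}\!\}+G(a\cdot b,c,d)=\mu(a,\{\!\{b,c,d\}\!\})+a\cdot G(b,c,d)$; (5) $\{\!\{a,\mu(b,c),d\}\!\}+G(a,b\cdot c,d)=\{\!\{a,b,\mu(c,d)\}\!\}+G(a,b,c\cdot d)$; (6) $\mu(a,\{b,c,d\})+a\cdot F(b,c,d)=\mu(\{\!\{a,b,c\}\!\},d)+G(a,b,c)\cdot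 d$; (7) $\{F(a,b,c),d,e\}+F(\{a,b,c\},d,e)=\{a,G(b,c,d),e\}+F(a,\{\!\{b,c,d\}\!\},e)=\{a,b,F(c,d,e)\}+F(a,b,\{c,d,e\})$; (8) $\{a,F(b,c,d),e\}+F(a,\{b,c,d\},e)=\{G(a,b,c),d,e\}+F(\{\!\{a,b,c\}\!\},d,e)$; (9) $\{\!\{G(a,b,c),d,e\}\!\}+G(\{\!\{a,b,c\}\!\},d,e)=\{\!\{a,F(b,c,d),e\}\!\}+G(a,\{b,c,d\},e)=\{\!\{a,b,G(c,d,e)\}\!\}+G(a,b,\{\!\{c,d,e\}\!\})$; (10) $\{\!\{a,G(b,c,d),e\}\!\}+G(a,\{\!\{b,c,d\}\!\},e)=\{\!\{a,b,F(c,d,e)\}\!\}+G(a,b,\{c,d,e\})$; (11) $\{a,b,G(c,d,e)\}+F(a,b,\{\!\{c,d,e\}\!\})=\{\!\{F(a,b,c),d,e\}\!\}+G(\{a,b,c\},d,e)$. For a linear map $f:A\to A$ put $\mu_f(a,b)=f(a)\cdot b+a\cdot f(b)-f(a\cdot b)$, $F_f(a,b,c)=\{f(a),b,c\}+\{a,f(b),c\}+\{a,b,f(c)\}-f(\{a,b,c\})$, $G_f(a,b,c)=\{\!\{f(a),b,c\}\!\}+\{\!\{a,f(b),c\}\!\}+\{\!\{a,b,f(c)\}\!\}-f(\{\!\{a,b,c\}\!\})$. A $(2,3)$-coboundary is a cocycle of the form $(\mu_f,F_f,G_f)$ for some linear $f$. $\mathcal{Z}^{(2,3)}(A,A)$ and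 $\mathcal{B}^{(2,3)}(A,A)$ are the spaces of $(2,3)$-cocycles and $(2,3)$-coboundaries, and $\mathcal{H}^{(2,3)}(A,A)=\mathcal{Z}^{(2,3)}(A,A)/\mathcal{B}^{(2,3)}(A,A)$. *)

(* Defs.v *)
From HB Require Import structures.
From mathcomp Require Import all_boot all_algebra.
From mathcomp Require Import boolp classical_sets functions.

Set Implicit Arguments.
Unset Strict Implicit.
Unset Printing Implicit Defensive.

Import GRing.Theory.
Local Open Scope ring_scope.
Local Open Scope quotient_scope.

(* Formal power series: [x i] is the coefficient of t^i in [x : fps V].  For a
   commutative ring R, [fps R] is the ring R[[t]] (Cauchy product); for an
   R-module V, [fps V] is V[[t]] as a module over [fps R].  The one-field record
   keeps these structures apart from the pointwise ones on [nat -> V]. *)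
Record fps (V : Type) := Fps { fcoef : nat -> V }.
Coercion fcoef : fps >-> Funclass.

HB.instance Definition _ (V : Type) := [isNew for @fcoef V].
HB.instance Definition _ (V : choiceType) := [Choice of fps V by <:].

Lemma fpsP (V : Type) (x y : fps V) : x =1 y -> x = y.
Proof. by case: x y => [x] [y] /funext /= ->. Qed.

Section FpsZmod.
Variable V : zmodType.

Definition fps_zero : fps V := Fps (fun=> 0).
Definition fps_opp (x : fps V) : fps V := Fps (fun i => - x i).
Definition fps_add (x y : fps V) : fps V := Fps (fun i => x i + y i).

Fact fps_addA : associative fps_add.
Proof. by move=> x y z; apply: fpsP => i /=; rewrite addrA. Qed.
Fact fps_addC : commutative fps_add.
Proof. by move=> x y; apply: fpsP => i /=; rewrite addrC. Qed.
Fact fps_add0 : left_id fps_zero fps_add.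
Proof. by move=> x; apply: fpsP => i /=; rewrite add0r. Qed.
Fact fps_addN : left_inverse fps_zero fps_opp fps_add.
Proof. by move=> x; apply: fpsP => i /=; rewrite addNr. Qed.

HB.instance Definition _ :=
  GRing.isZmodule.Build (fps V) fps_addA fps_addC fps_add0 fps_addN.

Lemma fps0E i : (0 : fps V) i = 0. Proof. by []. Qed.
Lemma fpsDE (x y : fps V) i : (x + y) i = x i + y i. Proof. by []. Qed.
Lemma fpsNE (x : fps V) i : (- x) i = - x i. Proof. by []. Qed.

Definition fpsC (a : V) : fps V := Fps (fun i => if i is 0%N then a else 0).

End FpsZmod.

Section FpsScale.
Variables (R : comNzRingType) (V : lmodType R).

Definition fps_scale (x : fps R) (v : fps V) : fps V :=
  Fps (fun n => \sum_(i < n.+1) x i *: v (n - i)%N).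

Lemma fps_scale_rev x v n :
  fps_scale x v n = \sum_(i < n.+1) x (n - i)%N *: v i.
Proof.
rewrite /= (reindex_inj rev_ord_inj) /=; apply: eq_bigr => i _.
by rewrite subSS subKn // -ltnS.
Qed.

End FpsScale.

Definition fps_mul (R : comNzRingType) (x y : fps R) : fps R :=
  Fps (fun n => \sum_(i < n.+1) x i * y (n - i)%N).

Section FpsScaleTheory.
Variables (R : comNzRingType) (V : lmodType R).
Implicit Types (x y : fps R) (v w : fps V).

Fact fps_scaleA x y v : fps_scale x (fps_scale y v) = fps_scale (fps_mul x y) v.
Proof.
apply: fpsP => n; rewrite [in RHS]fps_scale_rev /=.
pose h i j := x i *: (y (n - i - j)%N *: v j).
transitivity (\sum_(i < n.+1) \sum_(j < n.+1 | (j <= n - i)%N) h i j).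
  apply: eq_bigr => i _; rewrite -[\sum_(_ < _) _]/(fps_scale y v (n - i)%N).
  rewrite fps_scale_rev scaler_sumr (big_ord_widen n.+1 (h i)) //.
  by rewrite ltnS leq_subr.
rewrite (exchange_big_dep predT) //=; apply: eq_bigr => j _.
rewrite scaler_suml.
rewrite (big_ord_widen n.+1 (fun i => (x i * y (n - j - i)%N) *: v j));
  last by rewrite ltnS leq_subr.
apply: eq_big => [i|i le_j]; last by rewrite /h scalerA subnAC.
have leI (p : 'I_n.+1) : (p <= n)%N by rewrite -ltnS.
by rewrite ltnS leq_subRL // addnC -leq_subRL.
Qed.

Fact fps_scale1 : left_id (fpsC 1) (@fps_scale R V).
Proof.
move=> v; apply: fpsP => n /=; rewrite big_ord_recl /= scale1r subn0.
by rewrite big1 ?addr0 // => i _; rewrite scale0r.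
Qed.

Fact fps_scaleDr : right_distributive (@fps_scale R V) +%R.
Proof.
move=> x v w; apply: fpsP => n /=; rewrite -big_split /=.
by apply: eq_bigr => i _; rewrite scalerDr.
Qed.

Fact fps_scaleDl v : {morph (@fps_scale R V)^~ v : x y / x + y}.
Proof.
move=> x y; apply: fpsP => n /=; rewrite -big_split /=.
by apply: eq_bigr => i _; rewrite scalerDl.
Qed.

End FpsScaleTheory.

Section FpsRing.
Variable R : comNzRingType.

Fact fps_mulA : associative (@fps_mul R).
Proof. by move=> x y z; exact: (@fps_scaleA R R^o). Qed.
Fact fps_mulC : commutative (@fps_mul R).
Proof.
move=> x y; apply: fpsP => n; rewrite [LHS](@fps_scale_rev R R^o) /=.
by apply: eq_bigr => i _; rewrite mulrC.
Qed.
Fact fps_mul1 : left_id (fpsC 1) (@fps_mul R).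
Proof. exact: (@fps_scale1 R R^o). Qed.
Fact fps_mulDl : left_distributive (@fps_mul R) +%R.
Proof. by move=> x y z; exact: (@fps_scaleDl R R^o). Qed.
Fact fps_oner_neq0 : fpsC 1 != 0 :> fps R.
Proof.
by apply/eqP => /(congr1 (fun x : fps R => x 0%N)) /eqP; rewrite oner_eq0.
Qed.

HB.instance Definition _ := GRing.Zmodule_isComNzRing.Build (fps R)
  fps_mulA fps_mulC fps_mul1 fps_mulDl fps_oner_neq0.

Lemma fpsME (x y : fps R) n :
  (x * y) n = \sum_(i < n.+1) x i * y (n - i)%N.
Proof. by []. Qed.

End FpsRing.

Section FpsLmod.
Variables (R : comNzRingType) (V : lmodType R).

HB.instance Definition _ := GRing.Zmodule_isLmodule.Build (fps R) (fps V)
  (@fps_scaleA R V) (@fps_scale1 R V) (@fps_scaleDr R V) (@fps_scaleDl R V).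

Lemma fpsZE (x : fps R) (v : fps V) n :
  (x *: v) n = \sum_(i < n.+1) x i *: v (n - i)%N.
Proof. by []. Qed.

Lemma fpsC_linear (c : R) (a b : V) :
  fpsC (c *: a + b) = fpsC c *: fpsC a + fpsC b.
Proof.
apply: fpsP => n; rewrite fpsDE fpsZE big_ord_recl /= subn0 big1 => [|i _].
  by case: n => [|n]; rewrite ?scaler0 ?addr0.
by rewrite scale0r.
Qed.

Lemma fpsCZE (c : R) (v : fps V) n : (fpsC c *: v) n = c *: v n.
Proof.
rewrite fpsZE big_ord_recl /= subn0 big1 ?addr0 // => i _.
by rewrite scale0r.
Qed.

Definition fpsX : fps R := Fps (fun i => (i == 1%N)%:R).
Definition fps_tail (v : fps V) : fps V := Fps (fun i => v i.+1).

Lemma fpsXZE (v : fps V) n : (fpsX *: v) n = if n is m.+1 then v m else 0.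
Proof.
rewrite fpsZE big_ord_recl /= scale0r add0r; case: n => [|n].
  by rewrite big_ord0.
rewrite big_ord_recl /= scale1r subSS subn0 big1 ?addr0 // => i _.
by rewrite scale0r.
Qed.

Lemma fps_split (v : fps V) : v = fpsX *: fps_tail v + fpsC (v 0%N).
Proof.
apply: fpsP => n; rewrite fpsDE fpsXZE.
by case: n => [|n]; rewrite /= ?add0r ?addr0.
Qed.

(* A k[[t]]-linear endomorphism of V[[t]] is determined modulo t^n by its values
   on V, without any continuity assumption; here for n <= 2. *)
Lemma fps_linear_coef0 (f : fps V -> fps V) (v : fps V) :
  linear f -> f v 0%N = f (fpsC (v 0%N)) 0%N.
Proof. by move=> fl; rewrite [v in LHS]fps_split fl fpsDE fpsXZE add0r. Qed.

Lemma fps_linear_coef1 (f : fps V -> fps V) (v : fps V) : linear f ->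
  f v 1%N = f (fpsC (v 0%N)) 1%N + f (fpsC (v 1%N)) 0%N.
Proof.
move=> fl; rewrite [v in LHS]fps_split fl fpsDE fpsXZE.
by rewrite (fps_linear_coef0 _ fl) addrC.
Qed.

End FpsLmod.

Definition trilinear (R : nzRingType) (V : lmodType R) (F : V -> V -> V -> V) :=
  [/\ forall b c, linear (fun a => F a b c),
      forall a c, linear (fun b => F a b c) &
      forall a b, linear (fun c => F a b c)].

Section AYAlgebra.
Variables (R : comNzRingType) (V : lmodType R).

(* F and G stand for the operations {a,b,c} and {{a,b,c}} respectively. *)
Record AY_axioms (mul : V -> V -> V) (F G : V -> V -> V -> V) : Prop := {
  AY_mul_bilinear : bilinear_for *:%R *:%R mul;
  AY_F_trilinear : trilinear F;
  AY_G_trilinear : trilinear G;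
  AY1 : forall a b c,
    mul (mul a b) c - mul a (mul b c) + F a b c - G a b c = 0;
  AY2 : forall a b c d, F (mul a b) c d = F a (mul b c) d;
  AY3 : forall a b c d, F a b (mul c d) = mul (F a b c) d;
  AY4 : forall a b c d, G (mul a b) c d = mul a (G b c d);
  AY5 : forall a b c d, G a (mul b c) d = G a b (mul c d);
  AY6 : forall a b c d, mul a (F b c d) = mul (G a b c) d;
  AY7 : forall a b c d e,
    F (F a b c) d e = F a (G b c d) e /\ F a (G b c d) e = F a b (F c d e);
  AY8 : forall a b c d e, F a (F b c d) e = F (G a b c) d e;
  AY9 : forall a b c d e,
    G (G a b c) d e = G a (F b c d) e /\ G a (F b c d) e = G a b (G c d e);
  AY10 : forall a b c d e, G a (G b c d) e = G a b (F c d e);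
  AY11 : forall a b c d e, F a b (G c d e) = G (F a b c) d e }.

Record AY_algebra := AYAlgebra {
  ay_mul : V -> V -> V;
  ay_F : V -> V -> V -> V;
  ay_G : V -> V -> V -> V;
  ay_axioms : AY_axioms ay_mul ay_F ay_G }.

Fact AY_op0 (S : AY_algebra) :
  ((forall a, ay_mul S 0 a = 0) * (forall a, ay_mul S a 0 = 0)) *
  ((forall a b, ay_F S 0 a b = 0) * (forall a b, ay_F S a 0 b = 0) *
   (forall a b, ay_F S a b 0 = 0)) *
  ((forall a b, ay_G S 0 a b = 0) * (forall a b, ay_G S a 0 b = 0) *
   (forall a b, ay_G S a b 0 = 0)).
Proof.
have [[ml mr] [F1 F2 F3] [G1 G2 G3] _ _ _ _ _ _ _ _ _ _ _] := ay_axioms S.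
have lin0 (f : V -> V) : linear f -> f 0 = 0.
  by move=> fl; have := fl (-1) 0 0; rewrite scaler0 addr0 scaleN1r addNr.
do !split=> *.
- exact: lin0 (ml _).
- exact: lin0 (mr _).
- exact: lin0 (F1 _ _).
- exact: lin0 (F2 _ _).
- exact: lin0 (F3 _ _).
- exact: lin0 (G1 _ _).
- exact: lin0 (G2 _ _).
- exact: lin0 (G3 _ _).
Qed.

Definition AY_hom (S T : AY_algebra) (phi : V -> V) : Prop :=
  [/\ linear phi,
      forall a b, phi (ay_mul S a b) = ay_mul T (phi a) (phi b),
      forall a b c, phi (ay_F S a b c) = ay_F T (phi a) (phi b) (phi c) &
      forall a b c, phi (ay_G S a b c) = ay_G T (phi a) (phi b) (phi c)].

End AYAlgebra.


Section Cohomology.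
Variables (k : fieldType) (A : lmodType k) (S : AY_algebra A).

Local Notation m := (ay_mul S).
Local Notation T := (ay_F S).
Local Notation D := (ay_G S).

(* (mu, F, G) is a (2,3)-cocycle with coefficients in the adjoint
   representation; m, T, D are the operations a.b, {a,b,c}, {{a,b,c}} of S. *)
Record AY_cocycle (mu : A -> A -> A) (F G : A -> A -> A -> A) : Prop := {
  cocycle_mu_bilinear : bilinear_for *:%R *:%R mu;
  cocycle_F_trilinear : trilinear F;
  cocycle_G_trilinear : trilinear G;
  cocycle1 : forall a b c,
    m (mu a b) c + mu (m a b) c - m a (mu b c) - mu a (m b c)
      + F a b c - G a b c = 0;
  cocycle2 : forall a b c d,
    T (mu a b) c d + F (m a b) c d = T a (mu b c) d + F a (m b c) d;
  cocycle3 : forall a b c d,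
    T a b (mu c d) + F a b (m c d) = mu (T a b c) d + m (F a b c) d;
  cocycle4 : forall a b c d,
    D (mu a b) c d + G (m a b) c d = mu a (D b c d) + m a (G b c d);
  cocycle5 : forall a b c d,
    D a (mu b c) d + G a (m b c) d = D a b (mu c d) + G a b (m c d);
  cocycle6 : forall a b c d,
    mu a (T b c d) + m a (F b c d) = mu (D a b c) d + m (G a b c) d;
  cocycle7 : forall a b c d e,
    T (F a b c) d e + F (T a b c) d e = T a (G b c d) e + F a (D b c d) e /\
    T a (G b c d) e + F a (D b c d) e = T a b (F c d e) + F a b (T c d e);
  cocycle8 : forall a b c d e,
    T a (F b c d) e + F a (T b c d) e = T (G a b c) d e + F (D a b c) d e;
  cocycle9 : forall a b c d e,
    D (G a b c) d e + G (D a b c) d e = D a (F b c d) e + G a (T b c d) e /\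
    D a (F b c d) e + G a (T b c d) e = D a b (G c d e) + G a b (D c d e);
  cocycle10 : forall a b c d e,
    D a (G b c d) e + G a (D b c d) e = D a b (F c d e) + G a b (T c d e);
  cocycle11 : forall a b c d e,
    T a b (G c d e) + F a b (D c d e) = D (F a b c) d e + G (T a b c) d e }.

Definition cochain23 : Type :=
  ((A -> A -> A) * (A -> A -> A -> A) * (A -> A -> A -> A))%type.
HB.instance Definition _ := GRing.Lmodule.on cochain23.

Definition is_cocycle23 : {pred cochain23} :=
  [pred x | `[< AY_cocycle x.1.1 x.1.2 x.2 >]].

Fact is_cocycle23_submod : submod_closed is_cocycle23.
Proof.
have [[ml mr] [T1 T2 T3] [D1 D2 D3] _ _ _ _ _ _ _ _ _ _ _] := ay_axioms S.
have lin2 (c : k) (u v u' v' : A) :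
    (c *: u + v) + (c *: u' + v') = c *: (u + u') + (v + v').
  by rewrite scalerDr addrACA.
have linN (c : k) (u v : A) : - (c *: u + v) = c *: (- u) + - v.
  by rewrite scalerN opprD.
have comb (c : k) (u v u' v' : A) : u = v -> u' = v' ->
  c *: u + u' = c *: v + v' by move=> -> ->.
have aux (mu mu' : A -> A -> A) (F F' G G' : A -> A -> A -> A) c :
    AY_cocycle mu F G -> AY_cocycle mu' F' G' ->
  AY_cocycle (fun a b => c *: mu a b + mu' a b)
             (fun x y z => c *: F x y z + F' x y z)
             (fun x y z => c *: G x y z + G' x y z).
  have swap (c' : k) (u v u' v' : A) :
      c *: (c' *: u + v) + (c' *: u' + v')
      = c' *: (c *: u + u') + (c *: v + v').
    by rewrite !scalerDr !scalerA [c * c']mulrC addrACA.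
  case=> -[mul mur] [F1 F2 F3] [G1 G2 G3] h1 h2 h3 h4 h5 h6 h7 h8 h9 h10 h11.
  case=> -[mul' mur'] [F1' F2' F3'] [G1' G2' G3'].
  move=> k1 k2 k3 k4 k5 k6 k7 k8 k9 k10 k11.
  split.
  - by split=> [b|a] c' x y /=; rewrite ?mul ?mul' ?mur ?mur' swap.
  - by split=> [b d|b d|b d] c' x y /=;
      rewrite ?F1 ?F1' ?F2 ?F2' ?F3 ?F3' swap.
  - by split=> [b d|b d|b d] c' x y /=;
      rewrite ?G1 ?G1' ?G2 ?G2' ?G3 ?G3' swap.
  - move=> x y z; rewrite ml mr !linN !lin2.
    by rewrite h1 k1 scaler0 addr0.
  - by move=> *; rewrite T1 T2 !lin2; exact: comb.
  - by move=> *; rewrite T3 ml !lin2; exact: comb.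
  - by move=> *; rewrite D1 mr !lin2; exact: comb.
  - by move=> *; rewrite D2 D3 !lin2; exact: comb.
  - by move=> *; rewrite mr ml !lin2; exact: comb.
  - move=> x y z t u; rewrite T1 T2 T3 !lin2.
    by split; apply: comb; case: (h7 x y z t u); case: (k7 x y z t u).
  - by move=> *; rewrite T1 T2 !lin2; exact: comb.
  - move=> x y z t u; rewrite D1 D2 D3 !lin2.
    by split; apply: comb; case: (h9 x y z t u); case: (k9 x y z t u).
  - by move=> *; rewrite D2 D3 !lin2; exact: comb.
  - by move=> *; rewrite T3 D1 !lin2; exact: comb.
split=> [|c x y]; last first.
  move=> /asboolW hx /asboolW hy; apply: asboolT.
  exact: (aux _ _ _ _ _ _ c hx hy).
apply: asboolT.
rewrite -[0 : cochain23]/((fun=> fun=> 0), (fun=> fun=> fun=> 0),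
                          (fun=> fun=> fun=> 0)).
have ml0 : bilinear_for *:%R *:%R (fun _ _ : A => 0 : A).
  by split=> [b|a] c x y /=; rewrite scaler0 addr0.
have tl0 : trilinear (fun _ _ _ : A => 0 : A).
  by split=> [b d|b d|b d] c x y /=; rewrite scaler0 addr0.
split=> //= *; rewrite ?AY_op0 ?subrr ?addr0 ?subr0 //; split=> //.
Qed.

HB.instance Definition _ :=
  GRing.isSubmodClosed.Build k cochain23 is_cocycle23 is_cocycle23_submod.

Record Z23 := MkZ23 { Z23_val : cochain23; _ : Z23_val \in is_cocycle23 }.
HB.instance Definition _ := [isSub for Z23_val].
HB.instance Definition _ := [Choice of Z23 by <:].
HB.instance Definition _ := [SubChoice_isSubLmodule of Z23 by <:].

Lemma Z23P (x : Z23) : AY_cocycle (\val x).1.1 (\val x).1.2 (\val x).2.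
Proof. by case: x => x /= /asboolW. Qed.

(* (mu_f, F_f, G_f) *)
Definition cobound23 (f : A -> A) : cochain23 :=
  (fun a b => m (f a) b + m a (f b) - f (m a b),
   fun a b c => T (f a) b c + T a (f b) c + T a b (f c) - f (T a b c),
   fun a b c => D (f a) b c + D a (f b) c + D a b (f c) - f (D a b c)).

Definition B23 : {pred Z23} :=
  [pred x | `[< exists f : {linear A -> A}, \val x = cobound23 f >]].

Fact B23_submod : submod_closed B23.
Proof.
have [[ml mr] [T1 T2 T3] [D1 D2 D3] _ _ _ _ _ _ _ _ _ _ _] := ay_axioms S.
have lin2 (c : k) (u v u' v' : A) :
    (c *: u + v) + (c *: u' + v') = c *: (u + u') + (v + v').
  by rewrite scalerDr addrACA.
have linN (c : k) (u v : A) : - (c *: u + v) = c *: (- u) + - v.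
  by rewrite scalerN opprD.
have cob c (f g : A -> A) :
    cobound23 (fun x => c *: f x + g x) = c *: cobound23 f + cobound23 g.
  congr (_, _, _); rewrite funeqE => a; rewrite funeqE => b /=.
  - by rewrite ml mr linN !lin2.
  - by rewrite funeqE => d; rewrite T1 T2 T3 linN !lin2.
  - by rewrite funeqE => d; rewrite D1 D2 D3 linN !lin2.
split=> [|c x y].
  apply: asboolT; exists \0; rewrite raddf0.
  have := cob (-1) \0 \0; rewrite scaleN1r addNr => <-.
  by congr cobound23; rewrite funeqE => a /=; rewrite scaler0 addr0.
move=> /asboolW[f fE] /asboolW[g gE]; apply: asboolT.
exists ((c \*: f) \+ g); rewrite linearP /= fE gE -cob.
by congr cobound23.
Qed.

HB.instance Definition _ := GRing.isSubmodClosed.Build k Z23 B23 B23_submod.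

(* Z/B; the quotient of the library is only additive, so the k-linear structure
   is added below. *)
Definition H23 : Type := Quotient.quot B23.
HB.instance Definition _ := GRing.Zmodule.on H23.
HB.instance Definition _ := EqQuotient.on H23.

Definition H23_class (x : Z23) : H23 := \pi_(Quotient.quot B23) x.

Lemma H23_classP (x y : Z23) : H23_class x = H23_class y <-> x - y \in B23.
Proof. by rewrite Quotient.idealrBE; split=> /eqP. Qed.

Fact H23_class_zmod : zmod_morphism H23_class.
Proof. by move=> x y; rewrite /H23_class raddfB. Qed.

Fact H23_reprK (u : H23) : H23_class (repr u) = u.
Proof. exact: reprK. Qed.

Definition H23_scale (c : k) (u : H23) : H23 := H23_class (c *: repr u).

Fact H23_scale_class c x : H23_scale c (H23_class x) = H23_class (c *: x).
Proof.
apply/H23_classP; rewrite -scalerBr rpredZ //.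
by apply/H23_classP; rewrite H23_reprK.
Qed.

Fact H23_class_add x y : H23_class (x + y) = H23_class x + H23_class y.
Proof. by rewrite /H23_class raddfD. Qed.

Fact H23_scaleA a b u : H23_scale a (H23_scale b u) = H23_scale (a * b) u.
Proof. by rewrite -[u]H23_reprK !H23_scale_class scalerA. Qed.
Fact H23_scale1 : left_id 1 H23_scale.
Proof. by move=> u; rewrite -[u]H23_reprK !H23_scale_class scale1r. Qed.
Fact H23_scaleDr : right_distributive H23_scale +%R.
Proof.
move=> a u v; rewrite -[u]H23_reprK -[v]H23_reprK.
by rewrite -H23_class_add !H23_scale_class scalerDr H23_class_add.
Qed.
Fact H23_scaleDl u : {morph H23_scale^~ u : a b / a + b}.
Proof.
move=> a b; rewrite -[u]H23_reprK.
by rewrite !H23_scale_class scalerDl H23_class_add.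
Qed.

HB.instance Definition _ := GRing.Zmodule_isLmodule.Build k H23
  H23_scaleA H23_scale1 H23_scaleDr H23_scaleDl.

Fact H23_class_linear : linear H23_class.
Proof. by move=> c x y; rewrite H23_class_add -H23_scale_class. Qed.
HB.instance Definition _ :=
  GRing.isLinear.Build k Z23 H23 *:%R H23_class H23_class_linear.

End Cohomology.

Arguments B23 {k A} S.

Section Deformation.
Variables (k : fieldType) (A : lmodType k) (S : AY_algebra A).

(* A formal deformation is an AY-algebra structure on A[[t]] over k[[t]] that
   reduces to S modulo t.  Writing mu_t(a, b) = sum_i t^i mu_i(a, b) for a, b in
   A defines the maps mu_i (and likewise F_i, G_i); their k-multilinearity
   follows from the k[[t]]-multilinearity of mu_t, F_t, G_t, see
   [def_mu_bilinear], [def_F_trilinear] and [def_G_trilinear]. *)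
Record formal_deformation := FormalDeformation {
  def_alg : @AY_algebra (fps k) (fps A);
  def_mul0 : forall a b, ay_mul def_alg (fpsC a) (fpsC b) 0%N = ay_mul S a b;
  def_F0 : forall a b c,
    ay_F def_alg (fpsC a) (fpsC b) (fpsC c) 0%N = ay_F S a b c;
  def_G0 : forall a b c,
    ay_G def_alg (fpsC a) (fpsC b) (fpsC c) 0%N = ay_G S a b c }.

Definition def_mu (E : formal_deformation) (i : nat) (a b : A) : A :=
  ay_mul (def_alg E) (fpsC a) (fpsC b) i.
Definition def_F (E : formal_deformation) (i : nat) (a b c : A) : A :=
  ay_F (def_alg E) (fpsC a) (fpsC b) (fpsC c) i.
Definition def_G (E : formal_deformation) (i : nat) (a b c : A) : A :=
  ay_G (def_alg E) (fpsC a) (fpsC b) (fpsC c) i.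

(* phi_t is a homomorphism with phi_t(a) = a mod t for a in A; the coefficients
   phi_i of phi_t(a) are linear in a because phi_t is k[[t]]-linear. *)
Definition equivalent_deformations (E E' : formal_deformation) : Prop :=
  exists phi : fps A -> fps A,
    AY_hom (def_alg E) (def_alg E') phi /\ forall a, phi (fpsC a) 0%N = a.

Section Infinitesimal.
Variable E : formal_deformation.

Lemma def_mu_bilinear i : bilinear_for *:%R *:%R (def_mu E i).
Proof.
have [ml mr] := AY_mul_bilinear (ay_axioms (def_alg E)).
by split=> [b|a] c x y; rewrite /def_mu fpsC_linear ?ml ?mr fpsDE fpsCZE.
Qed.

Lemma def_F_trilinear i : trilinear (def_F E i).
Proof.
have [F1 F2 F3] := AY_F_trilinear (ay_axioms (def_alg E)).
by split=> [b d|b d|b d] c x y;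
  rewrite /def_F fpsC_linear ?F1 ?F2 ?F3 fpsDE fpsCZE.
Qed.

Lemma def_G_trilinear i : trilinear (def_G E i).
Proof.
have [G1 G2 G3] := AY_G_trilinear (ay_axioms (def_alg E)).
by split=> [b d|b d|b d] c x y;
  rewrite /def_G fpsC_linear ?G1 ?G2 ?G3 fpsDE fpsCZE.
Qed.

Local Notation m := (ay_mul (def_alg E)).
Local Notation F := (ay_F (def_alg E)).
Local Notation G := (ay_G (def_alg E)).
Local Notation "a %:S" := (fpsC a) (at level 2, left associativity).

Fact def_coef1 :
  ((forall x b, m x b%:S 1%N = ay_mul S (x 1%N) b + def_mu E 1 (x 0%N) b) *
   (forall a x, m a%:S x 1%N = ay_mul S a (x 1%N) + def_mu E 1 a (x 0%N))) *
  ((forall x b c,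
     F x b%:S c%:S 1%N = ay_F S (x 1%N) b c + def_F E 1 (x 0%N) b c) *
   (forall a x c,
     F a%:S x c%:S 1%N = ay_F S a (x 1%N) c + def_F E 1 a (x 0%N) c) *
   (forall a b x,
     F a%:S b%:S x 1%N = ay_F S a b (x 1%N) + def_F E 1 a b (x 0%N))) *
  ((forall x b c,
     G x b%:S c%:S 1%N = ay_G S (x 1%N) b c + def_G E 1 (x 0%N) b c) *
   (forall a x c,
     G a%:S x c%:S 1%N = ay_G S a (x 1%N) c + def_G E 1 a (x 0%N) c) *
   (forall a b x,
     G a%:S b%:S x 1%N = ay_G S a b (x 1%N) + def_G E 1 a b (x 0%N))).
Proof.
have [[ml mr] [F1 F2 F3] [G1 G2 G3] _ _ _ _ _ _ _ _ _ _ _] :=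
  ay_axioms (def_alg E).
do !split=> *.
- by rewrite (fps_linear_coef1 _ (ml _)) def_mul0 addrC.
- by rewrite (fps_linear_coef1 _ (mr _)) def_mul0 addrC.
- by rewrite (fps_linear_coef1 _ (F1 _ _)) def_F0 addrC.
- by rewrite (fps_linear_coef1 _ (F2 _ _)) def_F0 addrC.
- by rewrite (fps_linear_coef1 _ (F3 _ _)) def_F0 addrC.
- by rewrite (fps_linear_coef1 _ (G1 _ _)) def_G0 addrC.
- by rewrite (fps_linear_coef1 _ (G2 _ _)) def_G0 addrC.
- by rewrite (fps_linear_coef1 _ (G3 _ _)) def_G0 addrC.
Qed.

Lemma infinitesimal_cocycle :
  AY_cocycle S (def_mu E 1) (def_F E 1) (def_G E 1).
Proof.
have [_ _ _ e1 e2 e3 e4 e5 e6 e7 e8 e9 e10 e11] := ay_axioms (def_alg E).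
have c1 (x y : fps A) : x = y -> x 1%N = y 1%N by move=> ->.
have C1 (a : A) : a%:S 1%N = 0 by [].
have C0 (a : A) : a%:S 0%N = a by [].
pose cE := (def_coef1, def_mul0 E, def_F0 E, def_G0 E, C1, C0, AY_op0 S,
            @add0r A).
split.
- exact: def_mu_bilinear.
- exact: def_F_trilinear.
- exact: def_G_trilinear.
- move=> a b c; have /c1 := e1 a%:S b%:S c%:S.
  by rewrite !(fpsDE, fpsNE) !cE opprD addrA.
- by move=> a b c d; have /c1 := e2 a%:S b%:S c%:S d%:S; rewrite !cE.
- move=> a b c d; have /c1 := e3 a%:S b%:S c%:S d%:S; rewrite !cE.
  by rewrite [in X in _ -> X](addrC (def_mu _ _ _ _)).
- move=> a b c d; have /c1 := e4 a%:S b%:S c%:S d%:S; rewrite !cE.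
  by rewrite [in X in _ -> X](addrC (def_mu _ _ _ _)).
- by move=> a b c d; have /c1 := e5 a%:S b%:S c%:S d%:S; rewrite !cE.
- move=> a b c d; have /c1 := e6 a%:S b%:S c%:S d%:S; rewrite !cE.
  by rewrite ![in X in _ -> X](addrC (def_mu _ _ _ _)).
- move=> a b c d e; have [/c1 + /c1] := e7 a%:S b%:S c%:S d%:S e%:S.
  by rewrite !cE.
- by move=> a b c d e; have /c1 := e8 a%:S b%:S c%:S d%:S e%:S; rewrite !cE.
- move=> a b c d e; have [/c1 + /c1] := e9 a%:S b%:S c%:S d%:S e%:S.
  by rewrite !cE.
- by move=> a b c d e; have /c1 := e10 a%:S b%:S c%:S d%:S e%:S; rewrite !cE.
- by move=> a b c d e; have /c1 := e11 a%:S b%:S c%:S d%:S e%:S; rewrite !cE.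
Qed.

Definition infinitesimal : Z23 S :=
  @MkZ23 _ _ S (def_mu E 1, def_F E 1, def_G E 1)
    (asboolT infinitesimal_cocycle).

End Infinitesimal.
End Deformation.

(* Main.v *)
Require Import Defs.
From HB Require Import structures.
From mathcomp Require Import all_boot all_algebra.
From mathcomp Require Import boolp.

Import GRing.Theory.
Local Open Scope ring_scope.

(** Comparing the coefficients of t in phi_t (mu_t (a, b)) = mu'_t (phi_t a, phi_t b)
    gives phi_1 (a . b) + mu_1 (a, b) = mu'_1 (a, b) + phi_1 a . b + a . phi_1 b,
    that is mu_1 - mu'_1 = mu_f for f = phi_1; the ternary operations are similar. *)

Section MultilinearCoef1.
Context {R : comNzRingType} {V : lmodType R}.

(** Expanding one argument at a time leaves no term with both [x 1] and [y 1]: that one carries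
    t^2. *)
Lemma fps_bilinear_coef1 (m : fps V -> fps V -> fps V) (x y : fps V) :
    bilinear_for *:%R *:%R m ->
  m x y 1%N = m (fpsC (x 0%N)) (fpsC (y 0%N)) 1%N
            + m (fpsC (x 1%N)) (fpsC (y 0%N)) 0%N
            + m (fpsC (x 0%N)) (fpsC (y 1%N)) 0%N.
Proof.
case=> ml mr; rewrite (fps_linear_coef1 x (ml y)).
by rewrite (fps_linear_coef1 y (mr _)) (fps_linear_coef0 y (mr _)) addrAC.
Qed.

(** The last three terms are bracketed because, for [x], [y], [z] of the form phi_t(a), they become
    the positive part of F_f. *)
Lemma fps_trilinear_coef1 (F : fps V -> fps V -> fps V -> fps V)
    (x y z : fps V) : trilinear F ->
  F x y z 1%N = F (fpsC (x 0%N)) (fpsC (y 0%N)) (fpsC (z 0%N)) 1%N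
              + (F (fpsC (x 1%N)) (fpsC (y 0%N)) (fpsC (z 0%N)) 0%N
               + F (fpsC (x 0%N)) (fpsC (y 1%N)) (fpsC (z 0%N)) 0%N
               + F (fpsC (x 0%N)) (fpsC (y 0%N)) (fpsC (z 1%N)) 0%N).
Proof.
case=> F1 F2 F3; rewrite (fps_linear_coef1 x (F1 y z)).
rewrite (fps_linear_coef1 y (F2 _ z)) (fps_linear_coef0 y (F2 _ z)).
rewrite (fps_linear_coef1 z (F3 _ _)) !(fps_linear_coef0 z (F3 _ _)).
by rewrite -!addrA; congr (_ + _); rewrite [LHS]addrC [LHS]addrAC [LHS]addrC.
Qed.

End MultilinearCoef1.

(** Scaling by a constant series acts coefficientwise, so each phi_i inherits linearity from
    phi_t. *)
Lemma fpsC_coef_linear {R : comNzRingType} {V : lmodType R}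
    (phi : fps V -> fps V) (i : nat) :
  linear phi -> linear (fun a => phi (fpsC a) i).
Proof. by move=> phil c a b; rewrite fpsC_linear phil fpsDE fpsCZE. Qed.

Lemma infinitesimal_diff {k : fieldType} {A : lmodType k} {S : AY_algebra A}
    (E E' : formal_deformation S) (phi : fps A -> fps A) :
    AY_hom (def_alg E) (def_alg E') phi -> (forall a, phi (fpsC a) 0%N = a) ->
  \val (infinitesimal E) - \val (infinitesimal E')
    = cobound23 S (fun a => phi (fpsC a) 1%N).
Proof.
case=> phil phim phiF phiG phi0.
(* Here [u], [v] are the two infinitesimals, [p] is phi_1 of a product and [q] the sum of products
   with phi_1 on one argument, so [q - p] is the coboundary. *)
have subP (u v p q : A) : u + p = v + q -> u - v = q - p.
  by move=> h; apply/eqP; rewrite subr_eq addrAC [q + v]addrC -h addrK.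
have ax := ay_axioms (def_alg E').
congr (_, _, _); rewrite funeqE => a; rewrite funeqE => b /=.
- apply: subP; have := congr1 (fun x : fps A => x 1%N) (phim (fpsC a) (fpsC b)).
  rewrite fps_linear_coef1 // (fps_bilinear_coef1 _ _ _ (AY_mul_bilinear ax)).
  (* [phi0] acts on both sides: it strips phi from mu_1(a, b) on the left and reduces the constant
     terms of phi_t(a), phi_t(b) to a, b on the right. *)
  by rewrite !phi0 !def_mul0 addrC -addrA.
- rewrite funeqE => c; apply: subP.
  have := congr1 (fun x : fps A => x 1%N) (phiF (fpsC a) (fpsC b) (fpsC c)).
  rewrite fps_linear_coef1 // (fps_trilinear_coef1 _ _ _ _ (AY_F_trilinear ax)).
  by rewrite !phi0 !def_F0 addrC.
- rewrite funeqE => c; apply: subP.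
  have := congr1 (fun x : fps A => x 1%N) (phiG (fpsC a) (fpsC b) (fpsC c)).
  rewrite fps_linear_coef1 // (fps_trilinear_coef1 _ _ _ _ (AY_G_trilinear ax)).
  by rewrite !phi0 !def_G0 addrC.
Qed.

Theorem proposition5p2 (k : fieldType) (char0 : [pchar k] =i pred0)
    (A : lmodType k) (S : AY_algebra A) (E E' : formal_deformation S)
    (eqEE' : equivalent_deformations E E') :
  infinitesimal E - infinitesimal E' \in B23 S /\
  H23_class (infinitesimal E) = H23_class (infinitesimal E').
Proof.
suff diffB : infinitesimal E - infinitesimal E' \in B23 S.
  by split=> //; apply/H23_classP.
have [phi [phi_hom phi0]] := eqEE'; have [phil _ _ _] := phi_hom.
apply: asboolT.
(* The witness is phi_1, packed as a linear map since [B23] quantifies over those. *)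
pose f : {linear A -> A} := HB.pack (fun a => phi (fpsC a) 1%N)
  (GRing.isLinear.Build k A A *:%R _ (fpsC_coef_linear phi 1 phil)).
by exists f; rewrite raddfB; exact: infinitesimal_diff.
Qed.
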